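(* Let $k\geq 2$ and $n$ be positive integers and let $\mathcal{F}\subset 2^{[n]}$ be a weakly $k$-cross-free family. Then $|\mathcal{F}|=O_{k}(n\log^{*}n)$.
   Context: $[n]=\{1,\dots,n\}$. Two sets $A,B\subset[n]$ are weakly crossing if $A\setminus B$, $B\setminus A$ and $A\cap B$ are all non-empty. A family is weakly $k$-cross-free if it does not contain $k$ pairwise weakly crossing sets. $\log^{*}n$ is the largest positive integer $i$ such that the $i$-fold iterated base-2 logarithm of $n$ exceeds $1$. $O_k(\cdot)$ means the implied constant may depend on $k$. *)

(* Defs.v *)
From Stdlib Require Import Reals.
From mathcomp Require Import all_boot.
Set Implicit Arguments. Unset Strict Implicit. Unset Printing Implicit Defensive.

Definition log2R (x : R) : R := Rdiv (ln x) (ln 2).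

Definition iter_log2 (i n : nat) : R := iter i log2R (INR n).

(* is_logstar n i : i is log* n, i.e. the largest positive integer i such
   that the i-fold iterated base-2 logarithm of n exceeds 1.  (The set of
   such i is an initial segment, so "i works and i+1 does not" = largest.) *)
Definition is_logstar (n i : nat) : Prop :=
  (0 < i)%N /\ Rlt 1 (iter_log2 i n) /\ ~ Rlt 1 (iter_log2 i.+1 n).

Definition weakly_crossing (T : finType) (A B : {set T}) : bool :=
  [&& A :\: B != set0, B :\: A != set0 & A :&: B != set0].

Definition weakly_k_cross_free (T : finType) (k : nat) (F : {set {set T}}) : Prop :=
  ~ exists G : {set {set T}},
      [/\ G \subset F, #|G| = k &
          {in G &, forall A B, A != B -> weakly_crossing A B}].

(* Main.v *)
Require Import Defs.
From Stdlib Require Import Reals Lra.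
From mathcomp Require Import all_boot zify.

(** The sets of F through a fixed point have no large antichain, since such an
    antichain is pairwise weakly crossing.  Hence the sets of size about 2^s
    through x form at most k chains.  In a chain, the steps that add at least t
    points are rare.  A step B < A that adds fewer than t points has a point y
    in A but not in B, and y is then missed by a set B that contains almost
    everything in A.  If y has small steps at only boundedly many scales, the
    step is paid for by y.  Otherwise larger and larger sets above A have y in a
    small step; if a chain has many such steps, picking suitable points y one
    after the other and collecting the sets that just miss them gives pairwise
    weakly crossing sets.  So the sets with size in [2^s0, 2^t) number O_k(n)
    as soon as t^(O(k)) <= 2^s0, and about 2 log* n such ranges of sizes cover
    everything up to n. *)

Set Implicit Arguments. Unset Strict Implicit. Unset Printing Implicit Defensive.

(** * Layers, thin steps and chained sets *)

Definition crossing_lt (T : finType) (k : nat) (F : {set {set T}}) : Prop :=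
  forall H : {set {set T}}, H \subset F ->
    {in H &, forall A B, A != B -> weakly_crossing A B} -> #|H| < k.

Definition layer (T : finType) (F : {set {set T}}) (s : nat) : {set {set T}} :=
  [set A in F | 2 ^ s <= #|A| < 2 ^ s.+1].

(** The witness [G] is any member of the layer, not the next set of a chosen chain, so the notion
    depends on [F] alone. *)
Definition thin (T : finType) (F : {set {set T}}) (t s : nat) (y : T)
    (E : {set T}) : bool :=
  (E \in layer F s) &&
  [exists G in layer F s,
     [&& G \subset E, y \in E :\: G & #|E :\: G| < t]].

(** The same [t] bounds the scales here and the gaps in [thin], so choosing a common scale later
    costs only a factor [t]. *)
Fixpoint chained (T : finType) (F : {set {set T}}) (t m s : nat) (y : T)
    (E : {set T}) : bool :=
  if m is m'.+1 then
    [exists s' : 'I_t, (s < s') &&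
       [exists E' : {set T},
          [&& thin F t s' y E', E \subset E' & chained F t m' s' y E']]]
  else true.

Definition unchained (T : finType) (F : {set {set T}}) (t m s : nat) : {set T} :=
  [set y | [exists E, thin F t s y E && ~~ chained F t m s y E]].

Lemma weakly_crossingC (T : finType) (A B : {set T}) :
  weakly_crossing A B = weakly_crossing B A.
Proof. by rewrite /weakly_crossing setIC andbCA. Qed.

Lemma free_crossing_lt (T : finType) (k : nat) (F : {set {set T}}) :
  weakly_k_cross_free k F -> crossing_lt k F.
Proof.
move=> free H HF Hcr; rewrite ltnNge; apply/negP => /card_geqP [u [uu su uH]].
apply: free; exists [set A in u]; split.
- by apply: subset_trans HF; apply/subsetP => A; rewrite inE; apply: uH.
- by rewrite cardsE; apply/eqP; rewrite -su; apply/eqP/card_uniqP.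
by move=> A B; rewrite !inE => Au Bu; apply: Hcr; apply: uH.
Qed.

Lemma crossing_common (T : finType) (A B : {set T}) (x : T) :
  x \in A -> x \in B -> ~~ (A \subset B) -> ~~ (B \subset A) ->
  weakly_crossing A B.
Proof.
move=> xA xB AB BA; rewrite /weakly_crossing !setD_eq0 AB BA /=.
by apply/set0Pn; exists x; rewrite inE xA.
Qed.

Lemma subset_leq_cardN (T : finType) (A B : {set T}) :
  #|B| < #|A| -> ~~ (A \subset B).
Proof. by rewrite ltnNge; apply: contra => /subset_leq_card. Qed.

Lemma layer_lt (T : finType) (F : {set {set T}}) (s s' : nat) (A B : {set T}) :
  A \in layer F s -> B \in layer F s' -> s < s' -> #|A| < #|B|.
Proof.
rewrite !inE => /and3P[_ _ hA] /and3P[_ hB _] ss.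
by apply: leq_trans hA (leq_trans _ hB); rewrite leq_exp2l.
Qed.

(** * Crossing families built from thin chains *)

Lemma pigeonhole (T : finType) (f : T -> nat) (Q t : nat) (J : {set T}) :
  {in J, forall x, f x < t} -> t * Q < #|J| ->
  exists s, Q < #|[set x in J | f x == s]|.
Proof.
elim: t J => [|t IH] J Hf hJ.
  have /card_gt0P[x xJ] : 0 < #|J| by [].
  by have := Hf _ xJ.
have [|small] := ltnP Q #|[set x in J | f x == t]|; first by exists t.
have [||s Hs] := IH [set x in J | f x != t].
- by move=> x; rewrite inE => /andP[/Hf + /negbTE ft]; rewrite ltnS leq_eqVlt ft.
- have -> : [set x in J | f x != t] = J :\: [set x in J | f x == t].
    by apply/setP => x; rewrite !inE; case: (x \in J); rewrite ?andbF ?andbT.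
  rewrite cardsD (setIidPr _); last by apply/subsetP => x; rewrite inE => /andP[].
  by move: hJ; rewrite mulSn; lia.
exists s; apply: leq_trans Hs (subset_leq_card _).
by apply/subsetP => x; rewrite !inE -andbA => /and3P[-> _ ->].
Qed.

(* G is obtained from the last point y of J: since J lies in E y and E y \ G has
   fewer than t points, G keeps most of J, and hence meets every member of S,
   while y witnesses that no member of S lies in G. *)
Lemma thin_crossing_set (T : finType) (F : {set {set T}}) (t s : nat)
    (S : {set {set T}}) (J : {set T}) (E : T -> {set T}) (rho : T -> nat) :
  S \subset F -> {in S &, forall A B, A != B -> weakly_crossing A B} ->
  {in S, forall A : {set T}, #|A| < 2 ^ s /\ J \subset A} ->
  {in J, forall y, thin F t s y (E y)} ->
  {in J &, forall x y, rho x <= rho y -> x \in E y} ->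
  0 < #|J| -> t <= #|J| ->
  exists G : {set T},
    [/\ G \in layer F s, G \notin S, #|J| < #|J :&: G| + t, G |: S \subset F
      & {in G |: S &, forall A B, A != B -> weakly_crossing A B}].
Proof.
move=> SF Scr HS HE HJ J0 tJ; have [y0 y0J] := card_gt0P J0.
pose y := [arg max_(z > y0 in J) rho z].
have [yJ ymax] : y \in J /\ {in J, forall z, rho z <= rho y}
  by rewrite /y; case: arg_maxnP.
have JE : J \subset E y by apply/subsetP => x xJ; apply: HJ => //; exact: ymax.
have /andP[Ey /existsP[G /and4P[GL GE /setDP[yE yG] Dt]]] := HE _ yJ.
have JG : #|J| < #|J :&: G| + t.
  rewrite -(cardsID G J) ltn_add2l.
  by apply: leq_ltn_trans Dt; apply/subset_leq_card/setSD.
have /card_gt0P[z /setIP[zJ zG]] : 0 < #|J :&: G|.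
  by rewrite -(ltn_add2r t) add0n; apply: leq_ltn_trans JG.
have /andP[GF /andP[sG _]] : (G \in F) && (2 ^ s <= #|G| < 2 ^ s.+1)
  by move: GL; rewrite inE.
have GS : {in S, forall A, G != A /\ weakly_crossing G A}.
  move=> A AS; have [As JA] := HS _ AS.
  have GA : ~~ (G \subset A) by apply: subset_leq_cardN; apply: leq_trans As sG.
  split; first by apply: contraNneq GA => ->.
  apply: (@crossing_common _ _ _ z) => //; first by apply: (subsetP JA).
  by apply: contra yG => /subsetP; apply; apply: (subsetP JA).
exists G; split=> //.
- by apply/negP => /GS[]; rewrite eqxx.
- by rewrite subUset sub1set GF.
move=> A B /setU1P[->|AS] /setU1P[->|BS]; rewrite ?eqxx //.
- by case: (GS _ BS).
- by rewrite weakly_crossingC; case: (GS _ AS).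
exact: Scr.
Qed.

(** Each level adds one new set [G] to [S]. The points of [J] that survive in [G] pass to the next
    sets of their chains; these contain the old ones, so the order [rho] still works, and they lie
    at a higher scale. A level costs fewer than [t] points and then a factor [t], whence the base
    [t.+1]. *)
Lemma thin_chains_cross (T : finType) (k : nat) (F : {set {set T}}) (t m : nat) :
  crossing_lt k F ->
  forall (s : nat) (S : {set {set T}}) (J : {set T}) (E : T -> {set T})
    (rho : T -> nat),
  S \subset F -> {in S &, forall A B, A != B -> weakly_crossing A B} ->
  {in S, forall A : {set T}, #|A| < 2 ^ s /\ J \subset A} ->
  {in J, forall y, thin F t s y (E y) && chained F t m s y (E y)} ->
  {in J &, forall x y, rho x <= rho y -> x \in E y} ->
  t.+1 ^ m.+1 <= #|J| -> #|S| + m.+1 < k.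
Proof.
move=> Hk; elim: m => [|m IH] s S J E rho SF Scr HS HE HJ hJ.
  have HE' : {in J, forall y, thin F t s y (E y)} by move=> x /HE/andP[].
  rewrite expn1 in hJ.
  have [||G [_ GnS _ S'F S'cr]] := thin_crossing_set SF Scr HS HE' HJ; try lia.
  by have := Hk _ S'F S'cr; rewrite cardsU1 GnS /= addnC.
have HE' : {in J, forall y, thin F t s y (E y)} by move=> x /HE/andP[].
have Q0 : 0 < t.+1 ^ m by rewrite expn_gt0.
have [||G [GL GnS JG S'F S'cr]] := thin_crossing_set SF Scr HS HE' HJ;
  try (move: hJ; rewrite !expnS; nia).
have [u Hu] : exists u : T -> nat * {set T}, forall x, x \in J :&: G ->
   [/\ s < (u x).1 < t, thin F t (u x).1 x (u x).2, E x \subset (u x).2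
     & chained F t m (u x).1 x (u x).2].
  apply: (@fin_all_exists _ _ (fun x (v : nat * {set T}) => x \in J :&: G -> [/\ s < v.1 < t, thin F t v.1 x v.2, E x \subset v.2
     & chained F t m v.1 x v.2])) => x.
  case: (boolP (x \in J :&: G)) => [/setIP[xJ _]|_]; last by exists (0, set0).
  have /andP[_ /= /existsP[s' /andP[ss' /existsP[E' /and3P[h1 h2 h3]]]]] := HE _ xJ.
  by exists (val s', E') => _; split => //=; rewrite ss' /=.
(* The predecessor makes the strict bound of [pigeonhole] yield [t.+1 ^ m.+1] points. *)
have [s' hs'] : exists s', (t.+1 ^ m.+1).-1 < #|[set x in J :&: G | (u x).1 == s']|.
  apply: (@pigeonhole _ _ _ t); first by move=> x /Hu[/andP[]].
  have : 0 < t.+1 ^ m.+1 by rewrite expn_gt0.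
  by move: hJ JG; rewrite (expnS _ m.+1); set P := t.+1 ^ m.+1; nia.
set J' := [set x in _ | _] in hs'.
have J'P x : x \in J' -> [/\ x \in J, x \in G, (u x).1 = s' & x \in J :&: G].
  by rewrite !inE => /andP[/andP[-> ->] /eqP ->].
have s's : s < s'.
  have /card_gt0P[x /J'P[_ _ <- /Hu[/andP[]]]] : 0 < #|J'| by lia.
  by [].
suff : #|G |: S| + m.+1 < k by rewrite cardsU1 GnS add1n addSnnS.
apply: (IH s' _ J' (fun x => (u x).2) rho) => //.
- move=> A /setU1P[->|/HS[As JA]]; split.
  + move: GL; rewrite inE => /and3P[_ _ h].
    by apply: leq_trans h _; rewrite leq_exp2l.
  + by apply/subsetP => x /J'P[].
  + by apply: leq_trans As _; rewrite leq_exp2l // ltnW.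
  + by apply: subset_trans JA; apply/subsetP => x /J'P[].
- by move=> x /J'P[_ _ <- /Hu[_ -> _ ->]].
- by move=> x x' /J'P[xJ _ _ _] /J'P[x'J _ _ /Hu[_ _ /subsetP h _]] r; apply/h/HJ.
- by lia.
Qed.

(* Sets that are chained to depth m but not m+1, one for each scale, are pairwise
   incomparable: a larger one above a smaller one would extend its chain. *)
Lemma card_unchained_scales (T : finType) (k : nat) (F : {set {set T}})
    (t m : nat) (y : T) :
  crossing_lt k F -> #|[set s : 'I_t | y \in unchained F t m s]| <= m * k.
Proof.
move=> Hk; elim: m => [|m IH].
  rewrite mul0n leqn0 cards_eq0; apply/eqP/setP => s; rewrite !inE.
  by apply/negbTE/existsP => -[E]; rewrite andbF.
(* Every scale unchained at depth [m.+1] is in [R] or was already unchained at depth [m], so each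
   depth adds at most [k] scales. *)
pose R := [set s : 'I_t | [exists E, [&& thin F t s y E, chained F t m s y E
  & ~~ chained F t m.+1 s y E]]].
apply: (@leq_trans #|[set s : 'I_t | y \in unchained F t m s] :|: R|).
  apply/subset_leq_card/subsetP => s; rewrite !inE => /existsP[E /andP[tE cE]].
  case: (boolP (chained F t m s y E)) => c; apply/orP; [right|left];
    by apply/existsP; exists E; rewrite tE c.
apply: leq_trans (leq_card_setU _ _).1 _; rewrite mulSn addnC leq_add //.
have [f Hf] : exists f : 'I_t -> {set T}, forall s, s \in R ->
   [&& thin F t s y (f s), chained F t m s y (f s)
  & ~~ chained F t m.+1 s y (f s)].
  apply: (@fin_all_exists _ _ (fun s E => s \in R ->
   [&& thin F t s y E, chained F t m s y E & ~~ chained F t m.+1 s y E])) => s.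
  case: (boolP (s \in R)) => [|_]; last by exists set0.
  by rewrite inE => /existsP[E hE]; exists E.
have fL s : s \in R -> (f s \in layer F s) && (y \in f s).
  move/Hf => /and3P[/andP[-> /existsP[G /and4P[_ _ /setDP[-> _] _]]] _ _] //.
have fF s : s \in R -> f s \in F by move/fL => /andP[]; rewrite inE => /andP[].
have lt s s' : s \in R -> s' \in R -> s < s' -> weakly_crossing (f s) (f s').
  move=> sR s'R ss'; have /andP[L1 y1] := fL _ sR; have /andP[L2 y2] := fL _ s'R.
  apply: crossing_common y1 y2 _ _; last exact/subset_leq_cardN/(layer_lt L1 L2).
  have /and3P[_ _] := Hf _ sR; apply: contra => sub /=.
  apply/existsP; exists s'; rewrite ss' /=; apply/existsP; exists (f s').
  by rewrite sub; have /and3P[-> -> _] := Hf _ s'R.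
have cr s s' : s \in R -> s' \in R -> s != s' -> weakly_crossing (f s) (f s').
  move=> sR s'R; rewrite -val_eqE /= neq_ltn => /orP[]; first exact: lt.
  by rewrite weakly_crossingC; apply: lt.
have inj : {in R &, injective f}.
  move=> s s' sR s'R e; apply/eqP/negPn/negP => /(cr _ _ sR s'R).
  by rewrite e /weakly_crossing setDv eqxx.
rewrite -(card_in_imset inj) ltnW //; apply: Hk.
  by apply/subsetP => A /imsetP[s sR ->]; apply: fF.
move=> A B /imsetP[s sR ->] /imsetP[s' s'R ->] ne; apply: cr => //.
by apply: contraNneq ne => ->.
Qed.

(** * Long chains through a point *)

(** Mirsky's argument: peel off the maximal sets, an antichain. The top of a long chain in the
    remainder is not maximal, so some set of [H] extends the chain. *)
Lemma long_chain (T : finType) (w : nat) (H : {set {set T}}) :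
  (forall K : {set {set T}}, K \subset H ->
     {in K &, forall A B : {set T}, A \subset B -> A = B} -> #|K| <= w) ->
  exists c : seq {set T},
    [/\ sorted (fun A B : {set T} => B \proper A) c, {subset c <= H}
      & #|H| <= w * size c].
Proof.
have [n] := ubnP #|H|; elim: n H => // n IH H; rewrite ltnS => Hn Hw.
have [H0|/set0Pn[A0 A0H]] := eqVneq H set0.
  by exists [::]; rewrite H0 cards0.
pose M := [set A in H | [forall B in H, ~~ (A \proper B)]].
have MH : M \subset H by apply/subsetP => A; rewrite inE => /andP[].
have Mw : #|M| <= w.
  apply: Hw => // A B; rewrite !inE => /andP[_ /forall_inP mA] /andP[BH _] AB.
  by have := mA _ BH; rewrite properE AB /= negbK => BA; apply/eqP; rewrite eqEsubset AB.
have M0 : 0 < #|M|.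
  pose A := [arg max_(A > A0 in H) #|A|].
  have [AH Amax] : A \in H /\ {in H, forall B : {set T}, #|B| <= #|A|}
    by rewrite /A; case: arg_maxnP.
  apply/card_gt0P; exists A; rewrite inE AH; apply/forall_inP => B BH.
  by apply/negP => /proper_card; rewrite ltnNge Amax.
have cH : #|H| = #|M| + #|H :\: M| by rewrite -(cardsID M H) (setIidPr MH).
have [||c [sc cH' Hc]] := IH (H :\: M); first by lia.
  by move=> K KH; apply: Hw; apply: subset_trans KH (subsetDl _ _).
have Hc' : #|H| <= w * (size c).+1 by rewrite cH mulnS leq_add.
case: c sc cH' Hc Hc' => [|A c] sc cH' Hc Hc'.
  (* An empty chain means that nothing remains, so all of [H] is an antichain and one set
     suffices. *)
  by exists [:: A0]; split=> // B; rewrite inE => /eqP ->.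
have /setDP[AH] : A \in H :\: M by apply: cH'; rewrite inE eqxx.
rewrite inE AH /= negb_forall_in => /exists_inP[B BH]; rewrite negbK => AB.
exists (B :: A :: c); split=> //; first by rewrite /= AB.
by move=> C; rewrite inE => /orP[/eqP->//|/cH'/setDP[]].
Qed.

Lemma long_chain_at (T : finType) (k : nat) (F H : {set {set T}}) (x : T) :
  crossing_lt k F -> H \subset F -> {in H, forall A : {set T}, x \in A} ->
  exists c : seq {set T},
    [/\ sorted (fun A B : {set T} => B \proper A) c, {subset c <= H}
      & #|H| <= k * size c].
Proof.
move=> Hk HF Hx; apply: long_chain => K KH anti; apply/ltnW/Hk.
  exact: subset_trans HF.
move=> A B AK BK ne; apply: (@crossing_common _ _ _ x); rewrite ?Hx ?(subsetP KH) //.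
  by apply: contraNN ne => /anti ->.
by rewrite eq_sym in ne; apply: contraNN ne => /anti ->.
Qed.

(** * Counting one layer *)

(** Each step down the chain is charged in one of three ways: a gap of at least [t] points to
    [#|A|], a step whose point is unchained to that point, and any other step to a new point of [J].
    The 1 is for the last set of the chain. *)
Lemma chain_thin_points (T : finType) (F : {set {set T}}) (t m s : nat)
    (A : {set T}) (c : seq {set T}) :
  path (fun A B : {set T} => B \proper A) A c ->
  {subset A :: c <= layer F s} ->
  exists (J : {set T}) (E : T -> {set T}),
    [/\ {in J, forall y, thin F t s y (E y) && chained F t m s y (E y)},
        {in J &, forall x y, #|E x| <= #|E y| -> x \in E y},
        {in J, forall y, E y \subset A}
      & t * size (A :: c) <= t * (1 + #|unchained F t m s :&: A| + #|J|) + #|A|].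
Proof.
set W := unchained F t m s.
elim: c A => [|B c IH] A /=.
  move=> _ _; exists set0, (fun=> set0).
  by split; try (by move=> x; rewrite inE); rewrite -addnA mulnDr -addnA leq_addr.
move=> /andP[/properP[BA [y yA yB]] pB] sL.
have [|J [E [J1 J2 J3 J4]]] := IH B pB; first by move=> C CB; apply: sL; rewrite inE CB orbT.
have AL : A \in layer F s by apply: sL; rewrite inE eqxx.
have BL : B \in layer F s by apply: sL; rewrite !inE eqxx orbT.
have cAB : #|A| = #|B| + #|A :\: B| by rewrite -(cardsID B A) (setIidPr BA).
have JB : {in J, forall x, x \in B}.
  by move=> x xJ; apply: (subsetP (J3 _ xJ)); apply: J2.
have J3' : {in J, forall y, E y \subset A} by move=> z /J3/subset_trans; apply.
have WAB : #|W :&: B| <= #|W :&: A| by apply/subset_leq_card/setIS.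
have [big|small] := leqP t #|A :\: B|.
  exists J, E; split=> //.
  by have := leq_mul (leqnn t) WAB; move: J4 => /=; lia.
have thA : thin F t s y A.
  rewrite /thin AL; apply/existsP; exists B; rewrite BL BA small inE yA yB //.
case: (boolP (chained F t m s y A)) => [chA|nchA]; last first.
  exists J, E; split=> //.
  (* Here [y] is the new unchained point, as it lies in [A] but not in [B]. *)
  suff lt : #|W :&: B| < #|W :&: A|.
    by have := leq_mul (leqnn t) lt; have := subset_leq_card BA; move: J4 => /=; lia.
  apply/proper_card/properP; split; first exact: setIS.
  exists y; last by rewrite inE (negbTE yB) andbF.
  by rewrite inE yA andbT inE; apply/existsP; exists A; rewrite thA.
have ltAB : #|B| < #|A| by apply/proper_card/properP; split=> //; exists y.
have yJ : y \notin J by apply: contra yB => /JB.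
have neJ x : x \in J -> (x == y) = false.
  by move=> xJ; apply: contraNF yJ => /eqP <-.
exists (y |: J), (fun x => if x == y then A else E x); split.
- by move=> x /setU1P[->|xJ]; rewrite ?eqxx ?thA // neJ ?J1.
- move=> x z /setU1P[->|xJ] /setU1P[->|zJ]; rewrite ?eqxx ?neJ //.
  (* The premise fails, since [E z] lies in [B], which is smaller than [A]. *)
  + by rewrite leqNgt (leq_ltn_trans (subset_leq_card (J3 _ zJ))) ?ltAB.
  + by move=> _; apply/(subsetP BA)/JB.
  + exact: J2.
- by move=> x /setU1P[->|xJ]; rewrite ?eqxx // neJ // J3'.
- rewrite cardsU1 yJ /=; have := leq_mul (leqnn t) WAB.
  by move: J4 => /=; lia.
Qed.

Lemma sum_card_mem (T : finType) (H : {set {set T}}) :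
  \sum_(A in H) #|A| = \sum_(x : T) #|[set A in H | x \in A]|.
Proof.
under eq_bigr => A _ do rewrite -sum1_card big_mkcond.
rewrite exchange_big /=; apply: eq_bigr => x _.
rewrite -sum1_card [RHS]big_mkcond [LHS]big_mkcond /=.
by apply: eq_bigr => A _; rewrite inE; case: (A \in H).
Qed.

Lemma card_layer (T : finType) (F : {set {set T}}) (s : nat) :
  2 ^ s * #|layer F s| <= \sum_(A in layer F s) #|A|.
Proof.
rewrite mulnC -sum_nat_const; apply: leq_sum => A.
by rewrite inE => /and3P[].
Qed.

(* The cover is the union of the maximal sets, which form an antichain. *)
Lemma card_cover_at (T : finType) (k : nat) (F : {set {set T}}) (s : nat) (x : T) :
  crossing_lt k F ->
  #|cover [set A in layer F s | x \in A]| <= k * 2 ^ s.+1.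
Proof.
move=> Hk; set H := [set A in _ | _].
pose M := [set A in H | [forall B in H, ~~ (A \proper B)]].
have MH : M \subset H by apply/subsetP => A; rewrite inE => /andP[].
have HP A : A \in H -> [/\ A \in F, #|A| < 2 ^ s.+1 & x \in A].
  by rewrite !inE -!andbA => /and4P[-> _ -> ->].
have Mk : #|M| < k.
  apply: Hk; first by apply/subsetP => A /(subsetP MH)/HP[].
  have M_max A B : A \in M -> B \in M -> A \subset B -> A = B.
    move=> /setIdP[_ /forall_inP mA] /setIdP[BH _] AB.
    by have := mA _ BH; rewrite properE AB negbK => BA; apply/eqP; rewrite eqEsubset AB.
  move=> A B AM BM ne; have [_ _ xA] := HP _ (subsetP MH _ AM).
  have [_ _ xB] := HP _ (subsetP MH _ BM); apply: crossing_common xA xB _ _.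
    by apply: contraNN ne => /M_max ->.
  by rewrite eq_sym in ne; apply: contraNN ne => /M_max ->.
have sub : cover H \subset \bigcup_(A in M) A.
  apply/subsetP => z /bigcupP[A AH zA].
  pose B := [arg max_(B > A | (B \in H) && (A \subset B)) #|B|].
  have [/andP[BH AB] Bmax] : (B \in H) && (A \subset B) /\
    forall C, (C \in H) && (A \subset C) -> #|C| <= #|B|.
    by rewrite /B; case: arg_maxnP; rewrite ?AH /=.
  apply/bigcupP; exists B; last exact: (subsetP AB).
  rewrite inE BH; apply/forall_inP => C CH; apply/negP => BC.
  have := proper_card BC; rewrite ltnNge Bmax // CH.
  exact: subset_trans AB (proper_sub BC).
apply: leq_trans (subset_leq_card sub) _.
apply: leq_trans (leq_card_cover _) _.
apply: (@leq_trans (#|M| * 2 ^ s.+1)); last by rewrite leq_mul2r ltnW ?orbT.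
rewrite -sum_nat_const; apply: leq_sum => A /(subsetP MH)/HP[_ h _]; exact: ltnW.
Qed.

(** A single long chain represents all sets of the layer through [x], up to the factor [k]. Of the
    [3 * 2 ^ s], one part absorbs [J] and the last set through the hypothesis on [t], and two bound
    the largest set of the chain. *)
Lemma card_layer_at (T : finType) (k : nat) (F : {set {set T}}) (t s : nat) (x : T) :
  crossing_lt k F -> t * t.+1 ^ k.+1 <= 2 ^ s ->
  t * #|[set A in layer F s | x \in A]| <=
  k * (t * #|unchained F t k s :&: cover [set A in layer F s | x \in A]| + 3 * 2 ^ s).
Proof.
move=> Hk ht; set H := [set A in _ | _]; set W := unchained F t k s.
have HL A : A \in H -> A \in layer F s by rewrite inE => /andP[].
have [||c [sc cH Hc]] := @long_chain_at _ k F H x Hk.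
- by apply/subsetP => A /HL; rewrite inE => /andP[].
- by move=> A; rewrite inE => /andP[].
apply: (@leq_trans (t * (k * size c))); first by rewrite leq_mul2l Hc orbT.
rewrite mulnCA leq_mul2l; apply/orP; right.
case: c sc cH {Hc} => [|A c] sc cH; first by rewrite muln0.
have [|J [E [J1 J2 J3 Hs]]] := @chain_thin_points _ F t k s A c sc.
  by move=> B /cH/HL.
have AH : A \in H by apply: cH; rewrite inE eqxx.
have hJ : #|J| < t.+1 ^ k.+1.
  rewrite ltnNge; apply/negP => hJ.
  (* Starting from the empty family, depth [k] would yield [k.+1] crossing sets. *)
  have := @thin_chains_cross _ k F t k Hk s set0 J E (fun y => #|E y|).
  rewrite sub0set cards0 add0n => h.
  suff : k.+1 < k by rewrite ltnNge leqnSn.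
  by apply: h => //; move=> B; rewrite inE.
have hA : #|A| <= 2 * 2 ^ s.
  by move: (HL _ AH); rewrite inE => /and3P[_ _ h]; rewrite -expnS ltnW.
have hW : #|W :&: A| <= #|W :&: cover H|.
  by apply/subset_leq_card/setIS/bigcup_sup.
apply: leq_trans Hs _; rewrite -/W.
have := leq_mul (leqnn t) hJ; have := leq_mul (leqnn t) hW.
by move: ht hA; set P := t.+1 ^ k.+1; set Q := 2 ^ s; lia.
Qed.

(** Summing [card_layer_at] over [x] counts each set of the layer at least [2 ^ s] times. On the
    right, an unchained point appears once for each [x] sharing a member of the layer with it; this
    relation is symmetric, so [card_cover_at] bounds the number of such [x]. *)
Lemma card_unchained_layer (T : finType) (k : nat) (F : {set {set T}}) (t s : nat) :
  crossing_lt k F -> t * t.+1 ^ k.+1 <= 2 ^ s ->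
  t * #|layer F s| <= k * (2 * t * k * #|unchained F t k s| + 3 * #|T|).
Proof.
move=> Hk ht; set W := unchained F t k s.
pose U x := cover [set A in layer F s | x \in A].
have sW : \sum_x #|W :&: U x| <= #|W| * (k * 2 ^ s.+1).
  have -> : \sum_x #|W :&: U x| = \sum_(w in W) #|U w|.
    under eq_bigr => x _ do rewrite -sum1_card big_mkcond.
    rewrite exchange_big [RHS]big_mkcond /=; apply: eq_bigr => w _.
    case: ifP => wW; last by rewrite big1 // => x _; rewrite inE wW.
    rewrite -sum1_card [RHS]big_mkcond /=; apply: eq_bigr => x _.
    rewrite inE wW /=; suff -> : (w \in U x) = (x \in U w) by [].
    by apply/bigcupP/bigcupP => -[A]; rewrite inE => /andP[AL h1] h2;
      exists A => //; rewrite inE AL.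
  by rewrite -sum_nat_const; apply: leq_sum => w _; apply: card_cover_at.
have s0 : 0 < 2 ^ s by rewrite expn_gt0.
rewrite -(leq_pmul2l s0) mulnCA.
apply: (@leq_trans (t * \sum_(A in layer F s) #|A|)).
  by rewrite leq_mul2l card_layer orbT.
rewrite sum_card_mem big_distrr /=.
apply: (@leq_trans (\sum_x k * (t * #|W :&: U x| + 3 * 2 ^ s))).
  by apply: leq_sum => x _; apply: card_layer_at.
rewrite -big_distrr big_split -big_distrr /= sum_nat_const cardT -cardE.
have := leq_mul (leqnn (k * t)) sW; rewrite expnS; set Q := 2 ^ s; set X := \sum_x _; lia.
Qed.

(** * Summing over a block of scales *)

Lemma block_arith (k t Q N : nat) :
  Q <= N * (k * k) ->
  k * (2 * t * k * Q + t * (3 * N)) <= t * (k * (2 * (k * (k * k)) + 3) * N).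
Proof. by move=> /(leq_mul (leqnn (2 * t * k * k))); lia. Qed.

(** The factor [t] on the left of the layer bound cancels the at most [t] scales of the block, and
    each point is unchained at no more than [k * k] scales. The total is thus linear in [#|T|],
    whatever the block length. *)
Lemma card_block (T : finType) (k : nat) (F : {set {set T}}) (s0 t : nat) :
  crossing_lt k F -> t * t.+1 ^ k.+1 <= 2 ^ s0 ->
  #|[set A in F | 2 ^ s0 <= #|A| < 2 ^ t]| <= k * (2 * k ^ 3 + 3) * #|T|.
Proof.
move=> Hk ht; case: (posnP t) => [->|t0].
  rewrite expn0 (_ : [set _ in _ | _] = set0) ?cards0 //.
  apply/setP => A; rewrite !inE; apply/negbTE; rewrite negb_and.
  by apply/orP; right; have := expn_gt0 2 s0; lia.
rewrite -(leq_pmul2l t0).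
apply: (@leq_trans (\sum_(s < t | s0 <= s) t * #|layer F s|)).
  rewrite -big_distrr /= leq_mul2l; apply/orP; right.
  apply: (@leq_trans #|\bigcup_(s < t | s0 <= s) layer F s|).
    apply/subset_leq_card/subsetP => A; rewrite inE => /and3P[AF A1 A2].
    have A0 : 0 < #|A| by apply: leq_trans A1; rewrite expn_gt0.
    have /andP[B1 B2] := @trunc_log_bounds 2 #|A| isT A0.
    have st : trunc_log 2 #|A| < t.
      by rewrite -(@ltn_exp2l 2) //; apply: leq_ltn_trans A2.
    apply/bigcupP; exists (Ordinal st); last by rewrite inE AF B1.
    by rewrite /= -ltnS -(@ltn_exp2l 2) //; apply: leq_ltn_trans B2.
  elim/big_ind2: _ => [|A m B n hA hB|//]; first by rewrite cards0.
  by apply: leq_trans (leq_card_setU _ _).1 (leq_add hA hB).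
apply: (@leq_trans (\sum_(s < t) k * (2 * t * k * #|unchained F t k s| + 3 * #|T|))).
  rewrite big_mkcond; apply: leq_sum => s _; case: ifP => // s0s.
  by apply: card_unchained_layer => //; apply: leq_trans ht _; rewrite leq_exp2l.
have sW : \sum_(s < t) #|unchained F t k s| <= #|T| * (k * k).
  have -> : \sum_(s < t) #|unchained F t k s| =
            \sum_(y : T) #|[set s : 'I_t | y \in unchained F t k s]|.
    transitivity (\sum_(s < t) \sum_(y : T) (y \in unchained F t k s : nat)).
      by apply: eq_bigr => s _; rewrite -sum1_card big_mkcond; apply: eq_bigr => y _; case: ifP.
    rewrite exchange_big /=; apply: eq_bigr => y _.
    by rewrite -sum1_card [RHS]big_mkcond; apply: eq_bigr => s _; rewrite [in RHS]inE; case: ifP.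
  by rewrite -sum_nat_const; apply: leq_sum => y _; apply: card_unchained_scales.
rewrite -big_distrr big_split -big_distrr /= sum_nat_const card_ord.
rewrite !expnS expn0 muln1; exact: block_arith.
Qed.

(** * Small sets, and the cover of all sizes by blocks *)

Lemma size_chain (T : finType) (A : {set T}) (c : seq {set T}) :
  path (fun A B : {set T} => B \proper A) A c ->
  {in A :: c, forall B, B != set0} -> size (A :: c) <= #|A|.
Proof.
elim: c A => [|B c IH] A /= => [_ c0|/andP[BA pB] c0].
  by rewrite card_gt0 c0 ?mem_head.
apply: leq_ltn_trans (proper_card BA); apply: IH => // C Cc.
by apply: c0; rewrite inE Cc orbT.
Qed.

(** Every nonempty set is counted through its points, and a chain of nonempty sets of size below [m]
    has fewer than [m] members. The empty set gives the 1. *)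
Lemma card_small (T : finType) (k m : nat) (F : {set {set T}}) :
  crossing_lt k F -> #|[set A in F | #|A| < m]| <= 1 + #|T| * (k * m).
Proof.
move=> Hk; set H := [set A in _ | _].
rewrite (cardsD1 set0) leq_add ?leq_b1 //.
apply: (@leq_trans (\sum_(A in H :\ set0) #|A|)).
  rewrite -sum1_card; apply: leq_sum => A; rewrite !inE -card_gt0 => /andP[] //.
rewrite sum_card_mem -sum_nat_const; apply: leq_sum => x _.
have [||c [sc cH Hc]] := @long_chain_at _ k F [set A in H :\ set0 | x \in A] x Hk.
- by apply/subsetP => A; rewrite !inE -!andbA => /and3P[].
- by move=> A; rewrite inE => /andP[].
apply: leq_trans Hc _; rewrite leq_mul2l; apply/orP; right.
case: c sc cH => // A c sc cH.
have /setIdP[/setD1P[_ /setIdP[_ Am]] _] := cH A (mem_head _ _).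
apply: leq_trans (ltnW Am).
by apply: size_chain sc _ => B /cH; rewrite inE => /andP[_ xB]; apply/set0Pn; exists x.
Qed.
(* The block of sizes that starts at 2^(q b) ends at 2^(2^b - 1), and the next
   block starts at 2^(q (next_scale q b)), with no gap.  Two steps exponentiate b. *)
Definition next_scale (q b : nat) : nat := (2 ^ b - 1) %/ q.

(** With [b = 3 * q + c] this reads [q * (b + q) < 2 ^ b], the form used for one step of
    [next_scale]. *)
Lemma expn2_cubic (q c : nat) : q * (4 * q + c) < 2 ^ (3 * q + c).
Proof.
have h1 : q.+1 ^ 3 <= 2 ^ (3 * q) by rewrite (mulnC 3) expnM leq_exp2r // ltn_expl.
have h2 : c < 2 ^ c by apply: ltn_expl.
rewrite expnD; apply: leq_trans (leq_mul h1 h2); rewrite !expnS expn0; nia.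
Qed.

Lemma next_scale_add (q b : nat) : 0 < q -> 3 * q <= b -> b + q <= next_scale q b.
Proof.
move=> q0 /subnKC <-; rewrite leq_divRL // leq_subRL ?expn_gt0 // add1n.
by apply: leq_trans (expn2_cubic _ _); rewrite ltnS; nia.
Qed.

Lemma next_scale2 (q b : nat) :
  0 < q -> 3 * q <= b -> 2 ^ b <= next_scale q (next_scale q b).
Proof.
move=> q0 qb; rewrite leq_divRL // leq_subRL ?expn_gt0 // add1n.
apply: (@leq_trans (2 ^ (b + q))); last by rewrite leq_exp2l // next_scale_add.
rewrite expnD -ltn_divLR ?mulKn ?ltn_pmul2l ?expn_gt0 //.
have := ltn_expl q (ltnSn 1).
have : 0 < 2 ^ b by rewrite expn_gt0.
nia.
Qed.

Definition tower (i : nat) : nat := iter i (expn 2) 1.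

Lemma iter_next_scale (q i : nat) : 0 < q ->
  3 * q <= iter i.*2 (next_scale q) (3 * q) /\
  tower i <= iter i.*2 (next_scale q) (3 * q).
Proof.
move=> q0; elim: i => [|i [IH1 IH2]]; first by rewrite /=; lia.
rewrite doubleS !iterS; split.
  apply: leq_trans (next_scale2 q0 IH1); apply: leq_trans IH1 (ltnW _).
  exact: ltn_expl.
by apply: leq_trans (next_scale2 q0 IH1); rewrite leq_exp2l.
Qed.

Lemma card_below_block (T : finType) (k : nat) (F : {set {set T}}) (b : nat) :
  crossing_lt k F ->
  #|[set A in F | #|A| < 2 ^ (2 ^ b - 1)]| <=
  #|[set A in F | #|A| < 2 ^ (k.+2 * b)]| + k * (2 * k ^ 3 + 3) * #|T|.
Proof.
(* The block ends at [t = 2 ^ b - 1] so that [t.+1] is a power of 2 and the condition of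
   [card_block] holds with [s0 = k.+2 * b]. *)
move=> Hk; have ht : (2 ^ b - 1) * (2 ^ b - 1).+1 ^ k.+1 <= 2 ^ (k.+2 * b).
  rewrite subn1 prednK ?expn_gt0 // (mulnC k.+2) expnM [leqRHS]expnS.
  by rewrite leq_mul2r leq_pred orbT.
apply: leq_trans (leq_add (leqnn _) (card_block Hk ht)).
apply: leq_trans (leq_card_setU _ _).1; apply/subset_leq_card/subsetP => A.
by rewrite !inE => /andP[-> ->]; case: ltnP.
Qed.

Lemma card_below_scale (T : finType) (k : nat) (F : {set {set T}}) (m : nat) :
  crossing_lt k F ->
  #|[set A in F | #|A| < 2 ^ (2 ^ iter m (next_scale k.+2) (3 * k.+2) - 1)]| <=
  1 + #|T| * (k * 2 ^ (k.+2 * (3 * k.+2))) + m.+1 * (k * (2 * k ^ 3 + 3) * #|T|).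
Proof.
move=> Hk; elim: m => [|m IH]; apply: leq_trans (card_below_block _ Hk) _.
  by rewrite mul1n leq_add2r card_small.
rewrite (mulSn m.+1) addnCA [leqLHS]addnC leq_add2l; apply: leq_trans IH.
apply/subset_leq_card/subsetP => A; rewrite !inE => /andP[-> h].
(* Rounding down in [next_scale] makes consecutive blocks meet or overlap. *)
by rewrite andTb (leq_trans h) // leq_exp2l // iterS mulnC leq_divM.
Qed.

(** * Iterated logarithms and the final count *)

(* Stdlib's [ln] is 0 on nonpositive numbers. *)
Lemma log2R_gt0 (x : R) : Rlt 0 (log2R x) -> Rlt 0 x.
Proof.
rewrite /log2R => h; case: (Rlt_dec 0 x) => // nx; exfalso; move: h.
rewrite /ln; case: (Rlt_dec 0 x) => // _; rewrite /Rdiv Rmult_0_l; exact: Rlt_irrefl.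
Qed.

Lemma log2R_le (x : R) (m : nat) :
  Rlt 0 x -> Rle (log2R x) (INR m) -> Rle x (INR (2 ^ m)).
Proof.
have ln2 := ln_lt_2; have l2 : Rlt 0 (ln 2) by lra.
move=> x0 h; have e : INR (2 ^ m) = exp (INR m * ln 2).
  elim: m {h} => [|m IH]; first by rewrite Rmult_0_l exp_0.
  rewrite expnS (mult_INR 2) IH (S_INR m) Rmult_plus_distr_r Rmult_1_l exp_plus.
  by rewrite (exp_ln 2) /=; lra.
rewrite e -[x in Rle x _]exp_ln //.
have le : Rle (ln x) (INR m * ln 2).
  rewrite (_ : ln x = Rmult (log2R x) (ln 2)); last by rewrite /log2R; field; lra.
  by apply: Rmult_le_compat_r => //; lra.
case: le => [lt|->]; [left; exact: exp_increasing | exact: Rle_refl].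
Qed.

(** The bound 1 on the [i.+1]-fold logarithm is undone one logarithm at a time, starting from
    [tower 1 = 2]. Positivity, needed to invert each logarithm, is inherited from the [i]-fold one,
    which exceeds 1. *)
Lemma logstar_tower (n i : nat) : is_logstar n i -> n <= tower i.+1.
Proof.
case=> _ [gt1 /Rnot_lt_le le1].
have pos j : j <= i -> Rlt 0 (iter_log2 (i - j) n).
  elim: j => [_|j IH ji]; first by rewrite subn0; lra.
  by apply: log2R_gt0; move: (IH (ltnW ji)); rewrite -{1}subSS subSn.
have le j : j <= i -> Rle (iter_log2 (i - j) n) (INR (tower j.+1)).
  elim: j => [_|j IH ji].
    apply: (@log2R_le _ 1); first exact: pos.
    by rewrite subn0; exact: le1.
  apply: (@log2R_le _ (tower j.+1)); first exact: pos.
  by move: (IH (ltnW ji)); rewrite -{1}subSS subSn.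
by move: (le i (leqnn i)); rewrite subnn => /INR_le/leP.
Qed.

(* Ground set [n] is modelled by 'I_n = {0,...,n-1}. *)
Theorem theorem2p2 (k : nat) (hk : (2 <= k)%N) :
  exists C : nat,
    forall (n : nat) (F : {set {set 'I_n}}),
      (0 < n)%N -> weakly_k_cross_free k F ->
      forall i : nat, is_logstar n i -> (#|F| <= C * n * i)%N.
Proof.
pose B := k * (2 * k ^ 3 + 3); pose D := k * 2 ^ (k.+2 * (3 * k.+2)).
(* The terms come from the empty set, the small sets and the [2 * i + 1] blocks; as [i] is at least
   1, [2 * i + 1 <= 3 * i]. *)
exists (1 + D + 3 * B) => n F n0 /free_crossing_lt Hk i star.
have i0 : 0 < i by case: star.
have [qb tb] := @iter_next_scale k.+2 i isT.
set b := iter _ _ _ in qb tb.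
have cF := @card_below_scale _ k F i.*2 Hk; rewrite -/B -/D -/b card_ord in cF.
suff FE : [set A in F | #|A| < 2 ^ (2 ^ b - 1)] = F.
  rewrite FE in cF; apply: leq_trans cF _; rewrite -addnn; clear -n0 i0; nia.
apply/setP => A; rewrite inE; case: (boolP (A \in F)) => // _ /=.
have hA : #|A| <= n by have := max_card A; rewrite card_ord.
(* What remains is [2 ^ tower i < 2 ^ (2 ^ b - 1)], which follows from
   [tower i <= b < 2 ^ b - 1]. *)
apply: leq_ltn_trans (leq_trans hA (logstar_tower star)) _.
rewrite /tower iterS -/(tower i) ltn_exp2l //; apply: leq_ltn_trans tb _.
apply: leq_trans (leq_div _ k.+2); apply: leq_trans (next_scale_add _ qb) => //.
by rewrite addnS ltnS leq_addr.
Qed.
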